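(* Let $\mathscr{H}$ be a complex Hilbert space with a fixed orthonormal basis, let $\mathscr{A}$ be a $C^*$-algebra of operators acting on $\mathscr{H}$, let $T$ be a compact Hausdorff space equipped with a Radon measure $\mu$, let $(A_t)_{t\in T}$ and $(B_t)_{t\in T}$ be fields in $\mathcal{C}(T,\mathscr{A})$ with the synchronous Hadamard property, i.e. $(A_t-A_s)\circ(B_t-B_s)\geq 0$ for all $s,t\in T$, and let $\alpha,\beta:T\to[0,+\infty)$ be measurable functions that are $\mu$-integrable. Then $$\int_{T}\alpha(s)\,d\mu(s)\int_{T}\beta(t)(A_t\circ B_t)\,d\mu(t)+\int_{T}\beta(s)\,d\mu(s)\int_{T}\alpha(t)(A_t\circ B_t)\,d\mu(t)$$ $$\geq\Big(\int_{T}\alpha(t)A_t\,d\mu(t)\Big)\circ\Big(\int_{T}\beta(s)B_s\,d\mu(s)\Big)+\Big(\int_{T}\beta(t)A_t\,d\mu(t)\Big)\circ\Big(\int_{T}\alpha(s)B_s\,d\mu(s)\Big).$$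
   Context: $\mathbb{B}(\mathscr{H})$ is the algebra of bounded linear operators on $\mathscr{H}$. An operator $X$ is positive ($X\geq 0$) if $\langle Xx,x\rangle\geq 0$ for all $x\in\mathscr{H}$; $X\geq Y$ means $X-Y\geq 0$. Given the fixed orthonormal basis $\{e_j\}$ of $\mathscr{H}$, the Hadamard product $A\circ B$ of $A,B\in\mathbb{B}(\mathscr{H})$ is the operator determined by $\langle (A\circ B)e_i,e_j\rangle=\langle Ae_i,e_j\rangle\langle Be_i,e_j\rangle$ for all $i,j$. Equivalently, $A\circ B=U^*(A\otimes B)U$, where $U:\mathscr{H}\to\mathscr{H}\otimes\mathscr{H}$ is the isometry with $Ue_j=e_j\otimes e_j$. $\mathcal{C}(T,\mathscr{A})$ is the set of continuous fields of operators: families $(A_t)_{t\in T}$ in $\mathscr{A}$ such that $t\mapsto A_t$ is norm continuous on $T$ and $t\mapsto\|A_t\|$ is integrable. Integrals of operator-valued functions are Bochner integrals. *)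

(* Defs.v *)
From HB Require Import structures.
From mathcomp Require Import all_boot all_order all_algebra.
From mathcomp Require Import complex.
From mathcomp Require Import all_classical all_reals all_analysis.

Set Implicit Arguments.
Unset Strict Implicit.
Unset Printing Implicit Defensive.

Import Order.TTheory GRing.Theory Num.Theory.
Import numFieldNormedType.Exports.

Local Open Scope classical_set_scope.
Local Open Scope complex_scope.
Local Open Scope ring_scope.

HB.mixin Record CompleteNormedModule_isHilbert (R : realType) H
    & CompleteNormedModule R[i] H := {
  inner : {dot H for (@conjc R)} ;
  inner_norm : forall x : H, inner x x = `|x| ^+ 2
}.

#[short(type="hilbertType")]
HB.structure Definition Hilbert (R : realType) :=
  {H of CompleteNormedModule R[i] H & CompleteNormedModule_isHilbert R H}.

(* Linear in x, conjugate-linear in y. *)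
Notation "'⟨' x , y '⟩'" := (inner x y)
  (at level 0, x at level 99, y at level 99, format "'⟨' x ,  y '⟩'")
  : ring_scope.

(* The index type J is arbitrary: H need not be separable. *)
Definition orthonormal_basis (R : realType) (H : hilbertType R) (J : eqType)
    (e : J -> H) : Prop :=
  (forall i j, ⟨e i, e j⟩ = (i == j)%:R) /\
  closure [set x | exists (s : seq J) (c : J -> R[i]),
                     x = \sum_(j <- s) c j *: e j] = [set: H].

Section BoundedOperators.
Variables (R : realType) (H : hilbertType R).

Definition bounded_op_pred (f : H -> H) : Prop :=
  linear f /\ exists M : R[i], forall x, `|f x| <= M * `|x|.

Definition bounded_op : {pred H -> H} := [pred f | `[< bounded_op_pred f >]].

Record bop : Type := Bop { bop_fun :> H -> H ; _ : bop_fun \in bounded_op }.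

HB.instance Definition _ := [isSub for bop_fun].
HB.instance Definition _ := [Choice of bop by <:].

Lemma bopP (X : bop) : bounded_op_pred X.
Proof. by case: X => f /= /asboolP. Qed.

Lemma bopE (X Y : bop) : X =1 Y -> X = Y.
Proof. by move=> XY; apply/val_inj/funext. Qed.

Lemma bounded_op_submod : submod_closed bounded_op.
Proof.
split.
  apply/asboolP; split; first by move=> a x y; rewrite /= scaler0 addr0.
  by exists 0 => x; rewrite normr0 mul0r.
move=> a f g /asboolP[lf [M fM]] /asboolP[lg [N gN]].
apply/asboolP; split.
  move=> b x y /=; rewrite !fctE lf lg !scalerDr !scalerA.
  by rewrite addrACA [a * b]mulrC.
exists (`|a| * M + N) => x; rewrite !fctE (le_trans (ler_normD _ _))//.
by rewrite mulrDl lerD// normrZ -mulrA ler_wpM2l.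
Qed.

HB.instance Definition _ :=
  GRing.isSubmodClosed.Build R[i] (H -> H) bounded_op bounded_op_submod.
HB.instance Definition _ := [SubChoice_isSubLmodule of bop by <:].

Definition opnorm (X : bop) : R :=
  sup [set complex.Re `|X x| | x in [set x : H | `|x| <= 1]].

Let Re_normK (V : normedModType R[i]) (x : V) : (complex.Re `|x|)%:C = `|x|.
Proof. by rewrite RRe_real// normr_real. Qed.

Let Re_normCK (a : R[i]) : (complex.Re `|a|)%:C = `|a|.
Proof. by rewrite RRe_real// normr_real. Qed.

Let opnorm_has_sup (X : bop) :
  has_sup [set complex.Re `|X x| | x in [set x : H | `|x| <= 1]].
Proof.
split; first by exists (complex.Re `|X 0|), 0 => //=; rewrite normr0.
have [_ [M XM]] := bopP X; exists (complex.Re `|M|) => _ [x /= x1 <-].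
rewrite -lecR Re_normK Re_normCK.
have h0 : 0 <= M * `|x| by exact: le_trans (XM x).
rewrite (le_trans (XM x))// -(ger0_norm h0) normrM normr_id.
by rewrite ler_piMr.
Qed.

Lemma opnorm_ub (X : bop) x : `|x| <= 1 -> complex.Re `|X x| <= opnorm X.
Proof. by move=> x1; apply: (sup_upper_bound (opnorm_has_sup X)); exists x. Qed.

Lemma opnorm_lub (X : bop) (M : R) :
  (forall x, `|x| <= 1 -> complex.Re `|X x| <= M) -> opnorm X <= M.
Proof.
move=> XM; apply: ge_sup; first by case: (opnorm_has_sup X).
by move=> _ [x /= x1 <-]; exact: XM.
Qed.

Lemma bop_linear (X : bop) : linear X.
Proof. by case: (bopP X). Qed.

Lemma bop0r (X : bop) : X 0 = 0.
Proof. by have := bop_linear X (-1) 0 0; rewrite scaler0 addr0 scaleN1r addNr. Qed.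

Lemma bopZr (X : bop) a x : X (a *: x) = a *: X x.
Proof. by have := bop_linear X a x 0; rewrite bop0r !addr0. Qed.

Lemma opnormP (X : bop) x : `|X x| <= (opnorm X)%:C * `|x|.
Proof.
have [->|x0] := eqVneq x 0; first by rewrite bop0r !normr0 mulr0.
have nx0 : 0 < `|x| by rewrite normr_gt0.
have : complex.Re `|X (`|x|^-1 *: x)| <= opnorm X.
  by apply: opnorm_ub; rewrite normrZ normfV normr_id mulVf// gt_eqF.
rewrite -lecR Re_normK bopZr normrZ normfV normr_id.
by rewrite ler_pdivrMl// mulrC.
Qed.

Lemma opnormD (X Y : bop) : opnorm (X + Y) <= opnorm X + opnorm Y.
Proof.
apply: opnorm_lub => x x1.
have h : complex.Re `|(X + Y) x| <= complex.Re `|X x| + complex.Re `|Y x|.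
  by rewrite -lecR rmorphD/= !Re_normK; exact: ler_normD.
by rewrite (le_trans h)// lerD// opnorm_ub.
Qed.

Let opnormZ_le (a : R[i]) (X : bop) :
  opnorm (a *: X) <= complex.Re `|a| * opnorm X.
Proof.
have a0 : 0 <= complex.Re `|a| by rewrite -ler0c Re_normCK.
apply: opnorm_lub => x x1.
have -> : (a *: X) x = a *: X x by [].
rewrite normrZ -[X in complex.Re (X * _)]Re_normCK.
rewrite -[X in complex.Re (_ * X)]Re_normK.
by rewrite -rmorphM/= ler_wpM2l ?opnorm_ub.
Qed.

Lemma opnorm0 : opnorm 0 = 0.
Proof.
apply/eqP; rewrite eq_le; apply/andP; split.
  by apply: opnorm_lub => x _; rewrite [X in `|X|](_ : _ = 0)// normr0.
apply: le_trans (opnorm_ub 0 (x := 0) _); last by rewrite normr0.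
by rewrite [X in `|X|](_ : _ = 0)// normr0.
Qed.

Lemma opnormZ (a : R[i]) (X : bop) : opnorm (a *: X) = complex.Re `|a| * opnorm X.
Proof.
have [->|a0] := eqVneq a 0.
  by rewrite scale0r opnorm0 normr0 mul0r.
apply/eqP; rewrite eq_le opnormZ_le/=.
have na0 : 0 < complex.Re `|a| by rewrite -ltcR Re_normCK normr_gt0.
have := opnormZ_le a^-1 (a *: X); rewrite scalerA mulVf// scale1r.
rewrite normfV -[in X in _ <= X -> _]Re_normCK -fmorphV/= => h.
by rewrite -ler_pdivlMl.
Qed.

Lemma opnorm_eq0 (X : bop) : opnorm X = 0 -> X = 0.
Proof.
move=> X0; apply: bopE => x; apply/eqP; rewrite -normr_le0.
by have := opnormP X x; rewrite X0 mul0r.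
Qed.

Let norm_bop (X : bop) : R[i] := (opnorm X)%:C.

Let norm_bopD X Y : norm_bop (X + Y) <= norm_bop X + norm_bop Y.
Proof. by rewrite /norm_bop -rmorphD/= lecR opnormD. Qed.

Let norm_bopZ (a : R[i]) X : norm_bop (a *: X) = `|a| * norm_bop X.
Proof. by rewrite /norm_bop opnormZ rmorphM/= Re_normCK. Qed.

Let norm_bop_eq0 X : norm_bop X = 0 -> X = 0.
Proof. by case=> /opnorm_eq0. Qed.

HB.instance Definition _ := Lmodule_isNormed.Build R[i] bop
  norm_bopD norm_bopZ norm_bop_eq0.

Lemma bop_normE (X : bop) : `|X| = (opnorm X)%:C.
Proof. by []. Qed.

Lemma bop_comp_subproof (X Y : bop) : (X \o Y : H -> H) \in bounded_op.
Proof.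
apply/asboolP; split; first by move=> a x y /=; rewrite !bop_linear.
have X0 : 0 <= opnorm X.
  by rewrite -(_ : complex.Re `|X 0| = 0) ?opnorm_ub// ?bop0r normr0.
exists ((opnorm X)%:C * (opnorm Y)%:C) => x /=.
rewrite (le_trans (opnormP X (Y x)))// -mulrA ler_wpM2l ?opnormP//.
by rewrite ler0c.
Qed.

Definition bop_comp (X Y : bop) : bop := Bop (bop_comp_subproof X Y).

Definition is_adjoint (X Y : bop) : Prop := forall x y, ⟨X x, y⟩ = ⟨x, Y y⟩.

Definition op_pos (X : bop) : Prop := forall x, 0 <= ⟨X x, x⟩.

Definition op_ge (X Y : bop) : Prop := op_pos (X - Y).

(* A (not necessarily unital) concrete C*-algebra. *)
Definition cstar_algebra (A : set bop) : Prop :=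
  [/\ A 0 /\ (forall (a : R[i]) X Y, A X -> A Y -> A (a *: X + Y)),
      forall X Y, A X -> A Y -> A (bop_comp X Y),
      forall X, A X -> exists2 Y, A Y & is_adjoint X Y
    & closed A].

(* The operator with these matrix entries; it exists and is unique when e is an
   orthonormal basis. *)
Definition hadamard (J : Type) (e : J -> H) (X Y : bop) : bop :=
  xget (0 : bop) [set Z : bop | forall i j,
    ⟨Z (e i), e j⟩ = ⟨X (e i), e j⟩ * ⟨Y (e i), e j⟩].

End BoundedOperators.

Notation "A '>=op' B" := (op_ge A B) (at level 70, no associativity)
  : ring_scope.

Definition borel (T : ptopologicalType) := g_sigma_algebraType (@open T).

(* Locally finite, outer regular on Borel sets and inner regular on open sets.
   Meant for Hausdorff T, where compact sets are closed, hence measurable. *)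
Definition radon_measure (R : realType) (T : ptopologicalType)
    (mu : {measure set (borel T) -> \bar R}) : Prop :=
  [/\ forall K : set T, compact K -> (mu K < +oo)%E,
      forall E : set (borel T), measurable E ->
        mu E = ereal_inf [set mu U | U in [set U : set T | open U /\ E `<=` U]]
    & forall U : set T, open U ->
        mu U = ereal_sup [set mu K | K in
          [set K : set T | compact K /\ K `<=` U]]].

Section Bochner.
Context d (T : measurableType d) (R : realType) (V : normedModType R[i]).
Variable mu : {measure set T -> \bar R}.

Definition bochner_simple (s : T -> V) : Prop :=
  [/\ finite_set (range s),
      forall v, measurable (s @^-1` [set v])
    & forall v, v != 0 -> (mu (s @^-1` [set v]) < +oo)%E].

(* A value v = 0 of infinite measure contributes 0. *)
Definition bochner_sintegral (s : T -> V) : V :=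
  \sum_(v \in range s) (fine (mu (s @^-1` [set v])))%:C *: v.

Definition bochner_approx (f : T -> V) (s : nat -> T -> V) : Prop :=
  [/\ forall n, bochner_simple (s n),
      {ae mu, forall t, s n t @[n --> \oo] --> f t}
    & (\int[mu]_t (complex.Re `|f t - s n t|)%:E)%E @[n --> \oo] --> 0%E].

Definition bochner_integrable (f : T -> V) : Prop :=
  exists s, bochner_approx f s.

(* 0 when f is not Bochner integrable or when the limit does not exist. *)
Definition bochner_integral (f : T -> V) : V :=
  xget (0 : V) [set I : V | exists2 s, bochner_approx f s &
                    bochner_sintegral (s n) @[n --> \oo] --> I].

End Bochner.

Notation "\bint [ mu ]_ x f" := (bochner_integral mu (fun x => f))
  (at level 36, f at level 36, x at level 0,
   format "'[' \bint [ mu ]_ x '/  '  f ']'") : ring_scope.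

Definition continuous_field (R : realType) (H : hilbertType R)
    (T : ptopologicalType) (mu : {measure set (borel T) -> \bar R})
    (A : set (bop H)) (X : T -> bop H) : Prop :=
  [/\ forall t, A (X t), continuous X
    & mu.-integrable [set: borel T] (fun t => (opnorm (X t))%:E)].

Definition synchronous_hadamard (R : realType) (H : hilbertType R) (J : Type)
    (e : J -> H) (T : Type) (X Y : T -> bop H) : Prop :=
  forall s t, op_pos (hadamard e (X t - X s) (Y t - Y s)).

(* Main.v *)
Require Import Defs.
From HB Require Import structures.
From mathcomp Require Import all_boot all_order all_algebra.
From mathcomp Require Import complex.
From mathcomp Require Import all_classical all_reals all_analysis.
From mathcomp Require Import measurable_realfun.

Set Implicit Arguments.
Unset Strict Implicit.
Unset Printing Implicit Defensive.

Import Order.TTheory GRing.Theory Num.Theory.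
Import numFieldNormedType.Exports.
Import HBNNSimple.

Local Open Scope classical_set_scope.
Local Open Scope complex_scope.
Local Open Scope ring_scope.

(** Put [G t = \int alpha(s) (A_t - A_s) o (B_t - B_s) ds], where [o] is the
    Hadamard product.  It is positive, being an integral of positive operators
    with nonnegative weights.  Since [o] is bilinear and bounded it commutes
    with the integral, hence
      [G t = (\int alpha) (A_t o B_t) + \int alpha (A o B)
             - A_t o (\int alpha B) - (\int alpha A) o B_t].
    Integrating [beta(t) G t] in the same way gives exactly the difference of
    the two sides of the inequality, which is therefore positive.  Both
    integrations are carried out one variable at a time, so that no exchange
    of integrals occurs.

    Three facts carry this argument.

    The Hadamard product of bounded operators is a bounded operator, with
    [|X o Y| <= |X| |Y|] ([hadamard_exists]).  It is built one coordinate at a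
    time: the [j]-th coordinate of [(X o Y) x] has to be [<x, w_j>], where [w_j]
    has the coordinates [conj (X_ij Y_ij)], and square summability of all the
    coordinates involved follows from the Cauchy-Schwarz and Bessel
    inequalities; [riesz_fischer] turns square summable families into vectors.
    The basis is indexed by an arbitrary type, so square summable means that
    the finite partial sums are bounded.

    A continuous field on a compact space, weighted by a nonnegative integrable
    function, is Bochner integrable: it is a pointwise limit of finitely valued
    measurable fields and has integrable norm ([bochner_criterion]), and the
    integrals of the approximants converge because bounded operators form a
    complete space ([bop_cauchy_seq_cvg], [bochner_integral_spec]).

    The Bochner integral is determined by the real numbers [Re <X x, y>], which
    commute with it ([rcoef_bochner_integral]).  Linearity, positivity and the
    interchange with the Hadamard product all reduce through them to the
    Lebesgue integral of real functions. *)

(** * Inner products and orthonormal families *)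

Section InnerProduct.
Variables (R : realType) (H : hilbertType R).
Implicit Types (x y z : H) (a b : R[i]).

Lemma innerC x y : ⟨x, y⟩ = ⟨y, x⟩^*.
Proof. by rewrite hermC expr0 mul1r. Qed.

Lemma innerZl a x y : ⟨a *: x, y⟩ = a * ⟨x, y⟩.
Proof. exact: linearZl_LR. Qed.

Lemma innerZr a x y : ⟨x, a *: y⟩ = a^* * ⟨x, y⟩.
Proof. by rewrite linearZ. Qed.

Lemma innerDl x y z : ⟨x + y, z⟩ = ⟨x, z⟩ + ⟨y, z⟩.
Proof. exact: linearDl. Qed.

Lemma innerBl x y z : ⟨x - y, z⟩ = ⟨x, z⟩ - ⟨y, z⟩.
Proof. exact: linearBl. Qed.

Lemma innerBr x y z : ⟨x, y - z⟩ = ⟨x, y⟩ - ⟨x, z⟩.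
Proof. exact: linearBr. Qed.

Lemma inner_suml I (s : seq I) (f : I -> H) y :
  ⟨\sum_(i <- s) f i, y⟩ = \sum_(i <- s) ⟨f i, y⟩.
Proof. exact: linear_sumlz. Qed.

Lemma inner_sumr I (s : seq I) (f : I -> H) y :
  ⟨y, \sum_(i <- s) f i⟩ = \sum_(i <- s) ⟨y, f i⟩.
Proof. exact: linear_sumr. Qed.

Definition orthonormal_family (J : eqType) (e : J -> H) :=
  forall i j, ⟨e i, e j⟩ = (i == j)%:R.

Section Family.
Variables (J : eqType) (e : J -> H).
Hypothesis e1 : orthonormal_family e.

Lemma inner_combl (s : seq J) (c : J -> R[i]) j : uniq s ->
  ⟨\sum_(i <- s) c i *: e i, e j⟩ = if j \in s then c j else 0.
Proof.
move=> us; rewrite inner_suml; case: ifPn => js.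
  rewrite (bigD1_seq j)//= innerZl e1 eqxx mulr1 big1 ?addr0// => i ij.
  by rewrite innerZl e1 (negbTE ij) mulr0.
rewrite big1_seq// => i /andP[_ si]; rewrite innerZl e1.
by have [ij|] := eqVneq i j; [rewrite -ij si in js|rewrite mulr0].
Qed.

(** Pythagoras. *)
Lemma norm_comb (s : seq J) (c : J -> R[i]) : uniq s ->
  `|\sum_(i <- s) c i *: e i| ^+ 2 = \sum_(i <- s) `|c i| ^+ 2.
Proof.
move=> us; rewrite -inner_norm inner_sumr; apply: eq_big_seq => j js.
by rewrite innerZr inner_combl// js mulrC -normCK.
Qed.

(** The difference of [x] and its projection on the span of the [e i] has squared
    norm [|x|^2 - \sum |<x, e i>|^2]. *)
Lemma bessel (s : seq J) x : uniq s ->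
  \sum_(i <- s) `|⟨x, e i⟩| ^+ 2 <= `|x| ^+ 2.
Proof.
move=> us; set u := \sum_(i <- s) ⟨x, e i⟩ *: e i.
have xu : ⟨x, u⟩ = \sum_(i <- s) `|⟨x, e i⟩| ^+ 2.
  rewrite inner_sumr; apply: eq_bigr => i _.
  by rewrite innerZr mulrC -normCK.
have ux : ⟨u, x⟩ = \sum_(i <- s) `|⟨x, e i⟩| ^+ 2.
  rewrite inner_suml; apply: eq_bigr => i _.
  by rewrite innerZl [⟨e i, x⟩]innerC -normCK.
have : 0 <= `|x - u| ^+ 2 by rewrite exprn_ge0.
rewrite -inner_norm innerBr !innerBl xu ux [⟨u, u⟩]inner_norm norm_comb//.
by rewrite subrr subr0 inner_norm subr_ge0.
Qed.

End Family.

(** This is the Bessel inequality for the one-element family [y / |y|]. *)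
Lemma cauchy_schwarz x y : `|⟨x, y⟩| <= `|x| * `|y|.
Proof.
have [->|y0] := eqVneq y 0; first by rewrite linear0r !normr0 mulr0.
have ny : 0 < `|y| by rewrite normr_gt0.
pose f (_ : unit) := `|y|^-1 *: y.
have f1 : orthonormal_family f.
  case=> -[]; rewrite /f innerZl innerZr inner_norm eqxx/=.
  rewrite (_ : (`|y|^-1)^* = `|y|^-1); last first.
    by apply: CrealP; rewrite rpredV normr_real.
  by rewrite expr2 !mulrA -(mulrA _ `|y|^-1) mulVf ?gt_eqF// mulr1 mulVf ?gt_eqF.
have := bessel f1 x (s := [:: tt]) isT.
rewrite big_seq1 /f innerZr normrM norm_conjC normfV normr_id.
rewrite ler_pXn2r ?nnegrE ?mulr_ge0 ?invr_ge0//.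
by rewrite ler_pdivrMl// mulrC.
Qed.

End InnerProduct.

(** * Limits in complex normed spaces *)

Section Limits.
Variable R : realType.

Lemma gtc0_real (eps : R[i]) : 0 < eps -> exists2 d : R, 0 < d & eps = d%:C.
Proof.
move=> e0; have er : eps = (complex.Re eps)%:C by rewrite RRe_real// gtr0_real.
by exists (complex.Re eps) => //; rewrite -ltcR -er.
Qed.

(** Completeness with real thresholds: the norms take values in the complex
    numbers, but only their real parts are ever compared. *)
Lemma cauchy_seq_cvg (V : completeNormedModType R[i]) (u : nat -> V) :
  (forall d : R, 0 < d -> exists N, forall n m, (N <= n)%N -> (N <= m)%N ->
     `|u n - u m| <= d%:C) ->
  exists l : V, u n @[n --> \oo] --> l.
Proof.
move=> uc; have : cauchy (u @ \oo).
  apply: cauchy_exP => eps /gtc0_real[d d0 ->].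
  have [N uN] := uc (d / 2) (divr_gt0 d0 (ltr0n _ 2)).
  exists (u N); exists N => // n /= Nn.
  rewrite -ball_normE /=; apply: le_lt_trans (uN _ _ (leqnn N) Nn) _.
  by rewrite ltcR ltr_pdivrMr// ltr_pMr// ltr1n.
by move=> /cauchy_cvgP; exists (lim (u @ \oo)).
Qed.

Lemma cvg_invSn (V : normedModType R[i]) (u : nat -> V) (l : V) (M : R[i]) :
  0 <= M -> (forall n, `|l - u n| <= M / n.+1%:R) -> u n @[n --> \oo] --> l.
Proof.
move=> M0 ul; apply/cvgrPdist_lt => eps /gtc0_real[d d0 ->].
have [M' M'0 ME] : exists2 M' : R, 0 <= M' & M = M'%:C.
  exists (complex.Re M); last by rewrite RRe_real// ger0_real.
  by rewrite -lecR RRe_real// ger0_real.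
have : \forall n \near \oo, n.+1%:R^-1 < d / (M' + 1).
  have h : 0 < d / (M' + 1) by rewrite divr_gt0// ltr_wpDl.
  exact: (near_infty_natSinv_lt (PosNum h)).
apply: filterS => n nd; apply: le_lt_trans (ul n) _.
rewrite ME -(rmorph_nat (real_complex R)) -fmorphV -rmorphM ltcR.
have M1 : 0 < M' + 1 by rewrite ltr_wpDl.
move: nd; rewrite ltr_pdivlMr// => /(le_lt_trans _); apply.
by rewrite mulrC ler_wpM2l ?invr_ge0// lerDl.
Qed.

Lemma lip_continuous (V W : normedModType R[i]) (f : V -> W) (M : R[i]) :
  (forall x y, `|f x - f y| <= M * `|x - y|) -> continuous f.
Proof.
move=> fM x; apply/cvgrPdist_lt => eps e0.
have M1 : 0 < `|M| + 1 by rewrite ltr_wpDl.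
have : \forall y \near x, `|x - y| < eps / (`|M| + 1).
  exact: (@cvgr_dist_lt _ _ _ _ _ id x (@cvg_id _ _)) (divr_gt0 e0 M1).
apply: filterS => y; rewrite ltr_pdivlMr// => /(le_lt_trans _); apply.
have [->|xy] := eqVneq x y; first by rewrite !subrr !normr0 mul0r.
have nxy : 0 < `|x - y| by rewrite normr_gt0 subr_eq0.
have M0 : 0 <= M by rewrite -(pmulr_lge0 _ nxy) (le_trans _ (fM x y)).
by rewrite (le_trans (fM x y))// mulrC ler_wpM2l// ger0_norm// lerDl.
Qed.

Lemma cvg_norm_le (V : normedModType R[i]) (u : nat -> V) (l : V) (M : R[i]) :
  u n @[n --> \oo] --> l -> (\forall n \near \oo, `|u n| <= M) -> `|l| <= M.
Proof.
move=> /cvgrPdist_le ul uM; apply/ler_addgt0Pr => eps e0.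
have [n [un nM]] := filter_ex (filterI (ul _ e0) uM).
by rewrite -(subrK (u n) l) (le_trans (ler_normD _ _))// addrC lerD.
Qed.

End Limits.

(** * Square summable families of coordinates *)

Section Hilbert.
Variables (R : realType) (H : hilbertType R).
Implicit Types (x y z : H) (a b : R[i]).

Lemma inner_continuousl y : continuous (fun x : H => ⟨x, y⟩ : R[i]^o).
Proof.
apply: (@lip_continuous _ _ _ _ `|y|) => x z.
by rewrite -innerBl mulrC cauchy_schwarz.
Qed.

Variables (J : eqType) (e : J -> H).
Hypothesis he : orthonormal_basis e.

(** Finite combinations of the basis are dense and the zero set of a continuous
    map is closed. *)
Lemma eq0_on_basis_combs (V : normedModType R[i]) (f : H -> V) :
  continuous f -> (forall s c, f (\sum_(j <- s) c j *: e j) = 0) ->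
  forall x, f x = 0.
Proof.
move=> cf f0 x.
have dcl : closure [set x | exists (s : seq J) (c : J -> R[i]),
    x = \sum_(j <- s) c j *: e j] x by rewrite he.2.
have : closure [set 0 : V] (f x).
  move=> B fB; have /dcl[_ [[s [c ->]] /= Bw]] := cf x _ fB.
  by exists 0; split => //; move: Bw; rewrite f0.
rewrite -(closure_id _).1//.
exact/accessible_closed_set1/hausdorff_accessible/norm_hausdorff.
Qed.

Lemma inner_basis_inj x y : (forall j, ⟨x, e j⟩ = ⟨y, e j⟩) -> x = y.
Proof.
move=> xy; apply/eqP; rewrite -subr_eq0 -normr_eq0 -sqrf_eq0 -inner_norm.
apply/eqP; set d := x - y.
apply: (@eq0_on_basis_combs R[i]^o (fun x : H => ⟨x, d⟩)).
  exact: inner_continuousl.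
move=> s c; rewrite inner_suml big1// => j _.
by rewrite innerZl innerC innerBl xy subrr conjC0 mulr0.
Qed.

(** The index type may be uncountable, so [z] is obtained as the limit of a
    sequence of finite sums: the finite sets are chosen so that their sums of
    squares approach the supremum [S] over all finite sets.  Any two finite sums
    then differ little, because their symmetric difference contributes at most
    the two defects to [S]; and an index outside the chosen sets carries at most
    the remaining defect, so that the limit has the right coordinates. *)
Lemma riesz_fischer (c : J -> R[i]) (M : R[i]) : 0 <= M ->
  (forall s, uniq s -> \sum_(j <- s) `|c j| ^+ 2 <= M ^+ 2) ->
  exists2 z, (forall j, ⟨z, e j⟩ = c j) & `|z| <= M.
Proof.
move=> M0 cM; have e1 := he.1.
pose q s := \sum_(j <- s) complex.Re (`|c j| ^+ 2).
have qE s : (q s)%:C = \sum_(j <- s) `|c j| ^+ 2.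
  rewrite rmorph_sum; apply: eq_bigr => j _.
  by apply: RRe_real; rewrite rpredX// normr_real.
pose S := sup [set q s | s in [set s | uniq s]].
have hs : has_sup [set q s | s in [set s | uniq s]].
  split; first by exists (q [::]), [::].
  exists (complex.Re (M ^+ 2)) => _ [s /= us <-].
  by rewrite -lecR qE RRe_real ?rpredX ?ger0_real// cM.
have qS s : uniq s -> q s <= S.
  by move=> us; apply: (sup_upper_bound hs); exists s.
pose v s := \sum_(j <- s) c j *: e j.
(* Both sums are expanded over the union [r] of the two index lists; an index
   lying in both of them cancels. *)
have vv s t : uniq s -> uniq t ->
    `|v s - v t| ^+ 2 <= ((S - q s) + (S - q t))%:C.
  move=> us ut; pose r := undup (s ++ t).
  have ur : uniq r by exact: undup_uniq.
  have sub (V : nmodType) (w : seq J) (F : J -> V) : uniq w ->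
      {subset w <= r} ->
      \sum_(j <- w) F j = \sum_(j <- r) (if j \in w then F j else 0).
    move=> uw wr; rewrite (perm_big [seq j <- r | j \in w]).
      by rewrite big_filter big_mkcond.
    apply: uniq_perm => //; first exact: filter_uniq.
    by move=> j; rewrite mem_filter; case: (boolP (j \in w)) => // /wr ->.
  have sr : {subset s <= r} by move=> j js; rewrite mem_undup mem_cat js.
  have tr : {subset t <= r} by move=> j jt; rewrite mem_undup mem_cat jt orbT.
  have -> : v s - v t = \sum_(j <- r)
      (c j * ((j \in s)%:R - (j \in t)%:R)) *: e j.
    rewrite /v (sub _ s)// (sub _ t)// -sumrB; apply: eq_bigr => j _.
    by rewrite mulrBr scalerBl; do 2!case: ifP => _;
      rewrite ?mulr1 ?mulr0 ?scale0r.
  rewrite norm_comb//.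
  have -> : \sum_(j <- r) `|c j * ((j \in s)%:R - (j \in t)%:R)| ^+ 2 =
      ((q r - q s) + (q r - q t))%:C.
    have qr w : uniq w -> {subset w <= r} -> q r - q w = \sum_(j <- r)
        (complex.Re (`|c j| ^+ 2) -
         (if j \in w then complex.Re (`|c j| ^+ 2) else 0)).
      by move=> uw wr; rewrite sumrB -(sub _ w).
    rewrite qr// qr// -big_split.
    rewrite rmorph_sum; apply: eq_big_seq => j.
    rewrite mem_undup mem_cat => /orP jst.
    have cj : `|c j| ^+ 2 = (complex.Re (`|c j| ^+ 2))%:C.
      by rewrite RRe_real// rpredX// normr_real.
    rewrite normrM exprMn cj; move: (complex.Re _) => k.
    case: (j \in s) jst; case: (j \in t) => jst;
      rewrite ?subrr ?subr0 ?sub0r ?normrN ?normr1 ?normr0 ?expr1n ?expr0n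
              ?mulr1 ?mulr0 /= ?subrr ?subr0 ?addr0 ?add0r//.
    by case: jst.
  by rewrite lecR; apply: lerD; rewrite lerD2r qS.
have vj s j : uniq s -> `|⟨v s, e j⟩ - c j| ^+ 2 <= (S - q s)%:C.
  move=> us; rewrite (inner_combl e1)//; case: ifPn => js.
    by rewrite subrr normr0 expr0n/= lecR subr_ge0 qS.
  rewrite sub0r normrN -[leLHS]RRe_real; last by rewrite rpredX// normr_real.
  rewrite lecR lerBrDr.
  have -> : complex.Re (`|c j| ^+ 2) + q s = q (j :: s) by rewrite /q big_cons.
  by rewrite qS//= js.
(* The exponent and the factor [1/2] make the distance of two later sums at
   most [1 / (N + 1)]. *)
have ws n : exists s, uniq s /\ S - q s <= (n.+1%:R^-1) ^+ 2 / 2.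
  have d0 : 0 < (n.+1%:R^-1 : R) ^+ 2 / 2 by rewrite divr_gt0// exprn_gt0.
  have [_ [s /= us <-]] := sup_adherent d0 hs.
  by move=> /ltW; rewrite lerBlDl -lerBlDr => ?; exists s.
have [w wP] := choice ws.
have wc N n m : (N <= n)%N -> (N <= m)%N ->
    `|v (w n) - v (w m)| <= (N.+1%:R^-1)%:C.
  move=> Nn Nm; have [[un hn] [um hm]] := (wP n, wP m).
  rewrite -(ler_pXn2r (n := 2))// ?nnegrE ?lecR// ?invr_ge0//.
  rewrite (le_trans (vv _ _ un um))// -rmorphXn lecR.
  have h k : (N <= k)%N -> (k.+1%:R^-1 : R) ^+ 2 / 2 <= N.+1%:R^-1 ^+ 2 / 2.
    move=> Nk; rewrite ler_pM2r ?invr_gt0// ler_pXn2r ?nnegrE ?invr_ge0//.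
    by rewrite lef_pV2 ?posrE// ler_nat ltnS.
  rewrite [leRHS]splitr; apply: lerD; first exact: le_trans hn (h _ Nn).
  exact: le_trans hm (h _ Nm).
have [z wz] : exists z : H, v (w n) @[n --> \oo] --> z.
  apply: cauchy_seq_cvg => d d0.
  have [N _ /(_ N (leqnn N)) /= dN] := near_infty_natSinv_lt (PosNum d0).
  exists N => n m Nn Nm; apply: le_trans (wc _ _ _ Nn Nm) _.
  by rewrite lecR ltW.
exists z.
  move=> j; have h1 : ⟨v (w n), e j⟩ @[n --> \oo] --> (⟨z, e j⟩ : R[i]^o).
    exact: (cvg_comp _ _ wz (@inner_continuousl (e j) z)).
  have h2 : ⟨v (w n), e j⟩ @[n --> \oo] --> (c j : R[i]^o).
    apply: (@cvg_invSn _ _ _ _ 1) => // n; have [un hn] := wP n.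
    rewrite distrC mul1r -(ler_pXn2r (n := 2))// ?nnegrE ?invr_ge0//.
    rewrite (le_trans (vj _ _ un))// -(rmorph_nat (real_complex R)) -fmorphV.
    rewrite -rmorphXn lecR (le_trans hn)// ler_pdivrMr// ler_peMr ?sqr_ge0//.
    by rewrite ler1n.
  exact: cvg_unique h1 h2.
apply: cvg_norm_le wz _; apply: nearW => n; have [un hn] := wP n.
rewrite -(ler_pXn2r (n := 2))// ?nnegrE//.
by rewrite [leLHS](norm_comb e1 c un) cM.
Qed.

End Hilbert.

(** * Bounded operators *)

Section BopFacts.
Variables (R : realType) (H : hilbertType R).
Implicit Types (X Y Z : bop H) (x y : H).

Lemma bop_sum X I (s : seq I) (c : I -> R[i]) (f : I -> H) :
  X (\sum_(i <- s) c i *: f i) = \sum_(i <- s) c i *: X (f i).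
Proof.
elim: s => [|i s ih]; first by rewrite !big_nil bop0r.
by rewrite !big_cons bop_linear ih.
Qed.

Lemma bop_normP X x : `|X x| <= `|X| * `|x|.
Proof. exact: opnormP. Qed.

Lemma bop_norm_le X (M : R[i]) : 0 <= M ->
  (forall x, `|X x| <= M * `|x|) -> `|X| <= M.
Proof.
move=> M0 XM; have ME : (complex.Re M)%:C = M by rewrite RRe_real// ger0_real.
rewrite bop_normE -ME lecR; apply: opnorm_lub => x x1.
rewrite -lecR RRe_real ?normr_real// ME (le_trans (XM x))//.
exact: ler_piMr.
Qed.

Lemma bopB X x y : X (x - y) = X x - X y.
Proof. by rewrite [x - y]addrC -scaleN1r bop_linear scaleN1r addrC. Qed.

Lemma bop_continuous X : continuous (X : H -> H).
Proof.
apply: (@lip_continuous _ _ _ _ `|X|) => x y.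
by rewrite -bopB; exact: bop_normP.
Qed.

Lemma bop_subE X Y x : (X - Y) x = X x - Y x.
Proof. by []. Qed.

Lemma bop_addE X Y x : (X + Y) x = X x + Y x.
Proof. by []. Qed.

Lemma bop_scaleE (a : R[i]) X x : (a *: X) x = a *: X x.
Proof. by []. Qed.

End BopFacts.

(** * Existence and boundedness of the Hadamard product *)

Section Hadamard.
Variables (R : realType) (H : hilbertType R) (J : eqType) (e : J -> H).
Hypothesis he : orthonormal_basis e.
Implicit Types (X Y Z : bop H) (x y : H).

Let e1 : orthonormal_family e := he.1.

Lemma norm_basis j : `|e j| = 1.
Proof.
apply/eqP; rewrite -(eqrXn2 (n := 2))// expr1n -inner_norm he.1 eqxx//.
Qed.

Lemma bop_basis_inj X Y :
  (forall i j, ⟨X (e i), e j⟩ = ⟨Y (e i), e j⟩) -> X = Y.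
Proof.
move=> XY; apply/eqP; rewrite -subr_eq0; apply/eqP/bopE.
apply: (@eq0_on_basis_combs _ _ _ _ he).
  exact: bop_continuous.
move=> s c; rewrite bop_sum big1// => i _.
by rewrite bop_subE (inner_basis_inj he (XY i)) subrr scaler0.
Qed.

(** The terms are the squared coordinates of the adjoint of [X] at [y].  The
    adjoint is avoided by testing [X] on [u = \sum conj <X e_i, y> e_i], for
    which [<X u, y> = |u|^2]. *)
Lemma column_bound X y (s : seq J) : uniq s ->
  \sum_(i <- s) `|⟨X (e i), y⟩| ^+ 2 <= (`|X| * `|y|) ^+ 2.
Proof.
move=> us; pose u := \sum_(i <- s) (⟨X (e i), y⟩)^* *: e i.
have uE : `|u| ^+ 2 = \sum_(i <- s) `|⟨X (e i), y⟩| ^+ 2.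
  rewrite (norm_comb e1 _ us); apply: eq_bigr => i _.
  by rewrite norm_conjC.
have Xu : ⟨X u, y⟩ = `|u| ^+ 2.
  rewrite uE bop_sum inner_suml; apply: eq_bigr => i _.
  by rewrite innerZl mulrC -normCK.
rewrite -uE ler_pXn2r ?nnegrE ?mulr_ge0//.
have [->|u0] := eqVneq u 0; first by rewrite normr0 mulr_ge0.
have nu : 0 < `|u| by rewrite normr_gt0.
rewrite -(ler_pM2r nu) -expr2 -Xu (le_trans (real_ler_norm _))//.
  by rewrite Xu rpredX// normr_real.
rewrite (le_trans (cauchy_schwarz _ _))// mulrAC ler_wpM2r//.
exact: bop_normP.
Qed.

(** The sums are read as an inner product and as norms of combinations of the
    orthonormal family. *)
Lemma sum_cauchy_schwarz (s : seq J) (a b : J -> R[i]) : uniq s ->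
  `|\sum_(j <- s) a j * b j| ^+ 2 <=
  (\sum_(j <- s) `|a j| ^+ 2) * (\sum_(j <- s) `|b j| ^+ 2).
Proof.
move=> us; rewrite -(norm_comb e1 a us).
have -> : \sum_(j <- s) `|b j| ^+ 2 = `|\sum_(j <- s) (b j)^* *: e j| ^+ 2.
  by rewrite (norm_comb e1 _ us); apply: eq_bigr => j _; rewrite norm_conjC.
have -> : \sum_(j <- s) a j * b j =
    ⟨\sum_(j <- s) a j *: e j, \sum_(j <- s) (b j)^* *: e j⟩.
  rewrite inner_sumr; apply: eq_big_seq => j js.
  by rewrite innerZr conjCK (inner_combl e1)// js mulrC.
by rewrite -exprMn ler_pXn2r ?nnegrE ?mulr_ge0// cauchy_schwarz.
Qed.

(** The vector provided by [riesz_fischer] has the coordinates of [x], hence is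
    [x]. *)
Lemma norm_le_coord x (M : R[i]) : 0 <= M ->
  (forall s, uniq s -> \sum_(j <- s) `|⟨x, e j⟩| ^+ 2 <= M ^+ 2) -> `|x| <= M.
Proof.
move=> M0 xM; have [z zx zM] := riesz_fischer he M0 xM.
by rewrite -(inner_basis_inj he zx).
Qed.

(** Let [h i j] be the prescribed entries.  The vector [w j] with coordinates
    [conj (h i j)] exists because [|Y_ij| <= |Y|] and [\sum_i |X_ij|^2 <= |X|^2],
    and [Z x] is the vector with coordinates [<x, w j>].  These are square
    summable by duality: [\sum_j |<x, w j>|^2 = <x, \sum_j a_j w_j>] for
    [a_j = <x, w j>], and the map from [\sum_j a_j e_j] to [\sum_j a_j w_j] has
    norm at most [|X| |Y|].  The latter is the bound for the form
    [\sum_ij x_i conj(y_j) X_ij Y_ij], obtained by distributing [X_ij] and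
    [Y_ij] over the two factors of Cauchy-Schwarz. *)
Lemma hadamard_exists X Y : exists2 Z : bop H,
  forall i j, ⟨Z (e i), e j⟩ = ⟨X (e i), e j⟩ * ⟨Y (e i), e j⟩ &
  `|Z| <= `|X| * `|Y|.
Proof.
pose h i j := ⟨X (e i), e j⟩ * ⟨Y (e i), e j⟩.
set C := `|X| * `|Y|; have C0 : 0 <= C by rewrite mulr_ge0.
have Yle i j : `|⟨Y (e i), e j⟩| <= `|Y|.
  rewrite (le_trans (cauchy_schwarz _ _))// norm_basis mulr1.
  by rewrite (le_trans (bop_normP _ _))// norm_basis mulr1.
have Xle j s : uniq s -> \sum_(i <- s) `|⟨X (e i), e j⟩| ^+ 2 <= `|X| ^+ 2.
  by move=> us; rewrite (le_trans (column_bound _ _ us))// norm_basis mulr1.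
have /choice[w wE] : forall j, exists wj, forall i, ⟨wj, e i⟩ = (h i j)^*.
  move=> j; have [|wj wjE _] := riesz_fischer he (c := fun i => (h i j)^*) C0.
    move=> s us; rewrite /C exprMn (le_trans _ (ler_wpM2r _ (Xle j s us)))//.
      rewrite mulr_suml; apply: ler_sum => i _.
      by rewrite norm_conjC normrM exprMn ler_wpM2l ?exprn_ge0//
                 ler_pXn2r ?nnegrE.
  by exists wj.
have wbound s (a : J -> R[i]) : uniq s ->
    `|\sum_(j <- s) a j *: w j| <= C * `|\sum_(j <- s) a j *: e j|.
  move=> us; apply: norm_le_coord; first by rewrite mulr_ge0.
  move=> t ut; rewrite exprMn (norm_comb e1 a us) /C exprMn.
  have cE i : ⟨\sum_(j <- s) a j *: w j, e i⟩ =
      \sum_(j <- s) (a j * (⟨X (e i), e j⟩)^*) * (⟨Y (e i), e j⟩)^*.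
    rewrite inner_suml; apply: eq_bigr => j _.
    by rewrite innerZl wE rmorphM mulrA.
  have cle i : `|⟨\sum_(j <- s) a j *: w j, e i⟩| ^+ 2 <=
      (\sum_(j <- s) `|a j| ^+ 2 * `|⟨X (e i), e j⟩| ^+ 2) * `|Y| ^+ 2.
    rewrite cE (le_trans (sum_cauchy_schwarz _ _ us))//.
    under eq_bigr do rewrite normrM norm_conjC exprMn.
    apply: ler_wpM2l.
      by apply: sumr_ge0 => j _; rewrite mulr_ge0 ?exprn_ge0.
    under eq_bigr do rewrite norm_conjC.
    rewrite (le_trans (bessel e1 _ us))// ler_pXn2r ?nnegrE//.
    by rewrite (le_trans (bop_normP _ _))// norm_basis mulr1.
  apply: le_trans (ler_sum _ (fun i _ => cle i)) _.
  rewrite -mulr_suml exchange_big/= mulrAC ler_wpM2r ?exprn_ge0//.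
  rewrite mulr_sumr; apply: ler_sum => j _.
  by rewrite -mulr_sumr mulrC ler_wpM2r ?exprn_ge0// Xle.
have /choice[f fP] : forall x, exists z,
    (forall j, ⟨z, e j⟩ = ⟨x, w j⟩) /\ `|z| <= C * `|x|.
  move=> x; have M0 : 0 <= C * `|x| by rewrite mulr_ge0.
  have [|z zE zM] := riesz_fischer he (c := fun j => ⟨x, w j⟩) M0.
    move=> s us; pose a j := ⟨x, w j⟩; rewrite -(norm_comb e1 a us).
    (* By duality [|u|^2 = <x, \sum_j a_j w_j> <= |x| C |u|]. *)
    set u := \sum_(j <- s) a j *: e j.
    rewrite ler_pXn2r ?nnegrE//.
    have [->|u0] := eqVneq u 0; first by rewrite normr0.
    have nu : 0 < `|u| by rewrite normr_gt0.
    rewrite -(ler_pM2r nu) -expr2.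
    have -> : `|u| ^+ 2 = ⟨x, \sum_(j <- s) a j *: w j⟩.
      rewrite (norm_comb e1 a us) inner_sumr; apply: eq_bigr => j _.
      by rewrite innerZr mulrC -normCK.
    rewrite (le_trans (real_ler_norm _))//.
      rewrite inner_sumr rpred_sum// => j _.
      by rewrite innerZr mulrC -normCK rpredX// normr_real.
    rewrite (le_trans (cauchy_schwarz _ _))// mulrAC mulrC ler_wpM2r//.
    exact: wbound.
  by exists z.
have fb : f \in @bounded_op R H.
  apply/asboolP; split; last by exists C => x; have [] := fP x.
  move=> a x y; apply: (inner_basis_inj he) => j.
  by rewrite innerDl innerZl !(fP _).1 innerDl innerZl.
exists (Bop fb).
  by move=> i j; rewrite /= (fP _).1 innerC wE conjCK.
by apply: bop_norm_le => // x; have [] := fP x.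
Qed.

Lemma hadamardE X Y i j :
  ⟨hadamard e X Y (e i), e j⟩ = ⟨X (e i), e j⟩ * ⟨Y (e i), e j⟩.
Proof.
have [Z ZE _] := hadamard_exists X Y.
by rewrite /hadamard; case: xgetP => [W _ ->//|/(_ Z)].
Qed.

Lemma hadamard_norm X Y : `|hadamard e X Y| <= `|X| * `|Y|.
Proof.
have [Z ZE ZM] := hadamard_exists X Y.
by rewrite (_ : hadamard _ _ _ = Z)//; apply: bop_basis_inj => i j;
  rewrite hadamardE ZE.
Qed.

Lemma hadamard_linearl Y : linear (fun X => hadamard e X Y).
Proof.
move=> a X X'; apply: bop_basis_inj => i j.
by rewrite hadamardE !bop_addE !bop_scaleE !innerDl !innerZl !hadamardE
           mulrDl mulrA.
Qed.

End Hadamard.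

(** * Real-valued norms *)

Lemma normc_real (R : rcfType) (x : R) : `|x%:C| = `|x|%:C.
Proof. by rewrite normc_def /= expr0n addr0 sqrtr_sqr. Qed.

Section RealNorm.
Variables (R : realType) (V : normedModType R[i]).
Implicit Types v w : V.

Definition rnorm v : R := complex.Re `|v|.

Lemma rnormE v : (rnorm v)%:C = `|v|.
Proof. by rewrite RRe_real// normr_real. Qed.

Lemma rnorm_ge0 v : 0 <= rnorm v.
Proof. by rewrite -lecR rnormE; exact: normr_ge0. Qed.

Lemma rnormD v w : rnorm (v + w) <= rnorm v + rnorm w.
Proof. by rewrite -lecR rmorphD/= !rnormE ler_normD. Qed.

Lemma rnormN v : rnorm (- v) = rnorm v.
Proof. by rewrite /rnorm normrN. Qed.

Lemma rnormBC v w : rnorm (v - w) = rnorm (w - v).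
Proof. by rewrite /rnorm distrC. Qed.

Lemma rnorm0 : rnorm (0 : V) = 0.
Proof. by rewrite /rnorm normr0. Qed.

Lemma rnorm_eq0 v : (rnorm v == 0) = (v == 0).
Proof. by rewrite -(inj_eq (@complexI R)) rnormE normr_eq0. Qed.

Lemma rnorm_dist v w : `|rnorm v - rnorm w| <= rnorm (v - w).
Proof.
have tri a b : rnorm a <= rnorm b + rnorm (a - b).
  by rewrite -{1}(subrK b a) (le_trans (rnormD _ _))// addrC.
by rewrite ler_distl tri andbT lerBlDr rnormBC tri.
Qed.

Lemma cvg_rnorm (u : nat -> V) (l : V) (eps : R) : 0 < eps ->
  u n @[n --> \oo] --> l -> \forall n \near \oo, rnorm (l - u n) < eps.
Proof.
move=> e0 /cvgrPdist_lt/(_ eps%:C); rewrite ltcR => /(_ e0).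
by apply: filterS => n; rewrite -rnormE ltcR.
Qed.

(** The target is a real space and the source a complex one, so the Lipschitz
    condition on [psi] is expressed through the real norm. *)
Lemma lip_cvg (psi : V -> R) (C : R) (u : nat -> V) (l : V) : 0 <= C ->
  (forall v w, `|psi v - psi w| <= C * rnorm (v - w)) ->
  u n @[n --> \oo] --> l -> psi (u n) @[n --> \oo] --> psi l.
Proof.
move=> C0 psiC ul; apply/cvgrPdist_lt => eps e0.
have C1 : 0 < C + 1 by rewrite ltr_wpDl.
apply: filterS (cvg_rnorm (divr_gt0 e0 C1) ul) => n.
rewrite ltr_pdivlMr// => /(le_lt_trans _); apply.
by rewrite (le_trans (psiC _ _))// mulrC ler_wpM2l ?rnorm_ge0// lerDl.
Qed.

End RealNorm.

(** * Finitely valued measurable functions and strong measurability *)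

Section SimpleFunctions.
Context d (T : measurableType d).

(** Simple functions without any condition on the measures of the fibres.  The
    target has no measurable structure, hence the condition on singletons. *)
Definition finite_measurable (V : Type) (s : T -> V) : Prop :=
  finite_set (range s) /\ forall v, measurable (s @^-1` [set v]).

Lemma finite_measurable_preimage (V : Type) (s : T -> V) (Y : set V) :
  finite_measurable s -> measurable (s @^-1` Y).
Proof.
move=> [fs ms].
rewrite (_ : s @^-1` Y = \bigcup_(v in range s `&` Y) (s @^-1` [set v])).
  apply: fin_bigcup_measurable => [|v _]; last exact: ms.
  by apply: sub_finite_set fs => v [].
apply/seteqP; split => [t /= Yt|t [v [_ Yv] /= stv]]; last by rewrite stv.
by exists (s t).
Qed.

Lemma finite_measurable_comp (V W : Type) (s : T -> V) (g : V -> W) :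
  finite_measurable s -> finite_measurable (g \o s).
Proof.
move=> sm; split.
  have [fs _] := sm; rewrite (_ : range (g \o s) = g @` range s).
    exact: finite_image.
  by rewrite image_comp.
by move=> v; rewrite comp_preimage; exact: finite_measurable_preimage.
Qed.

Lemma finite_measurable_pair (V W : Type) (s : T -> V) (s' : T -> W) :
  finite_measurable s -> finite_measurable s' ->
  finite_measurable (fun t => (s t, s' t)).
Proof.
move=> [fs ms] [fs' ms']; split.
  apply: sub_finite_set (finite_setX fs fs') => _ [t _ <-].
  by split => /=; exists t.
move=> [v w]; rewrite (_ : _ @^-1` _ =
    (s @^-1` [set v]) `&` (s' @^-1` [set w])); first exact: measurableI.
by apply/seteqP; split => [t /= [<- <-]//|t /= [-> ->]].
Qed.

Lemma finite_measurable_if (V : Type) (U : set T) (s s' : T -> V) :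
  measurable U -> finite_measurable s -> finite_measurable s' ->
  finite_measurable (fun t => if t \in U then s t else s' t).
Proof.
move=> mU [fs ms] [fs' ms']; split.
  apply: (@sub_finite_set _ _ (range s `|` range s')).
    by move=> _ [t _ <-]; case: ifP => _; [left|right]; exists t.
  by rewrite finite_setU.
move=> v; rewrite (_ : _ @^-1` _ =
    (U `&` (s @^-1` [set v])) `|` (~` U `&` (s' @^-1` [set v]))).
  by apply: measurableU; apply: measurableI => //; exact: measurableC.
apply/seteqP; split => [t /=|t [[Ut /= sv]|[Ut /= sv]] /=].
- by case: ifPn => [/set_mem|/negP tU <-]; [left|right; split => // /mem_set].
- by rewrite mem_set.
- by rewrite memNset.
Qed.

Lemma finite_measurable_cst (V : Type) (v : V) :
  finite_measurable (fun=> v : V).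
Proof.
split; first by apply: sub_finite_set (finite_set1 v) => _ [t _ <-].
move=> w; have [->|vw] := pselect (v = w).
  by rewrite (_ : _ @^-1` _ = setT)//; apply/seteqP; split.
by rewrite (_ : _ @^-1` _ = set0)//; apply/seteqP; split.
Qed.

Lemma finite_measurable_fun (R : realType) (g : T -> R) :
  finite_measurable g -> measurable_fun [set: T] g.
Proof. by move=> gm _ Y mY; rewrite setTI; exact: finite_measurable_preimage. Qed.

(** The notion suited to Bochner integration: for a nonseparable target it is
    stronger than measurability of the preimages of open sets. *)
Definition strongly_measurable (V : topologicalType) (f : T -> V) : Prop :=
  exists s : nat -> T -> V, (forall n, finite_measurable (s n)) /\
    forall t, s n t @[n --> \oo] --> f t.

Section Normed.
Variables (R : realType) (V : normedModType R[i]).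

Lemma strongly_measurable_fun (psi : V -> R) (C : R) (f : T -> V) : 0 <= C ->
  (forall v w, `|psi v - psi w| <= C * rnorm (v - w)) ->
  strongly_measurable f -> measurable_fun [set: T] (psi \o f).
Proof.
move=> C0 psiC [s [sm sf]].
apply: (@measurable_fun_cvg _ _ _ _ (fun n => psi \o s n)).
  by move=> n; apply: finite_measurable_fun; exact: finite_measurable_comp.
by move=> t _; exact: lip_cvg C0 psiC (sf t).
Qed.

Lemma strongly_measurable_rnorm (f : T -> V) :
  strongly_measurable f -> measurable_fun [set: T] (fun t => rnorm (f t)).
Proof.
apply: (strongly_measurable_fun (psi := @rnorm R V) ler01) => v w.
by rewrite mul1r rnorm_dist.
Qed.

Lemma strongly_measurable_sub (f s : T -> V) :
  strongly_measurable f -> finite_measurable s ->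
  strongly_measurable (fun t => f t - s t).
Proof.
move=> [u [um uf]] sm; exists (fun n t => u n t - s t); split => [n|t].
  exact: (finite_measurable_comp (fun p => p.1 - p.2)
    (finite_measurable_pair (um n) sm)).
by apply: cvgB; [exact: uf|exact: cvg_cst].
Qed.

Lemma strongly_measurable_scale (alpha : T -> R) (f : T -> V) :
  (forall t, 0 <= alpha t) -> measurable_fun [set: T] alpha ->
  strongly_measurable f -> strongly_measurable (fun t => (alpha t)%:C *: f t).
Proof.
move=> alpha0 malpha [s [sm sf]].
have [|g [_ galpha]] := approximation measurableT
    (f := EFin \o alpha) _ (fun t _ => alpha0 t).
  exact/measurable_EFinP.
exists (fun n t => (g n t)%:C *: s n t); split => [n|t].
  have gm : finite_measurable (g n).
    split; first exact: fimfunP.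
    by move=> v; exact: measurable_sfunP.
  exact: (finite_measurable_comp (fun p : R * V => p.1%:C *: p.2)
    (finite_measurable_pair gm (sm n))).
apply: (@cvgZ R[i] V _ _ _ (fun n => (g n t)%:C) (s ^~ t)); last exact: sf.
apply/cvgrPdist_lt => eps /gtc0_real[r r0 ->].
have /fine_cvg/cvgrPdist_lt/(_ r r0) := galpha t I.
apply: filterS => n /=.
by rewrite -rmorphB normc_real ltcR.
Qed.

End Normed.

End SimpleFunctions.

Section CompactDomain.
Variables (R : realType) (V : normedModType R[i]) (T : ptopologicalType).

Lemma open_borel (U : set T) : open U -> measurable (U : set (borel T)).
Proof. exact: sub_sigma_algebra. Qed.

(** By compactness finitely many of the open sets where [F] is within [eps] of
    [F x] cover [T]; choosing the first of them that contains [t] gives a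
    finitely valued Borel function uniformly close to [F]. *)
Lemma continuous_strongly_measurable (F : T -> V) : compact [set: T] ->
  continuous F -> strongly_measurable (F : borel T -> V).
Proof.
move=> Tc cF.
have approx (eps : R) : 0 < eps -> exists s : borel T -> V,
    finite_measurable s /\ forall t, rnorm (F t - s t) < eps.
  move=> eps0; pose U x := F @^-1` ball (F x) eps%:C.
  have Uo x : open (U x).
    apply: open_comp; first by move=> ? _; exact: cF.
    by apply: ball_open; rewrite ltcR.
  have UE x t : U x t -> rnorm (F t - F x) < eps.
    by rewrite /U /= -ball_normE /= -rnormE ltcR rnormBC.
  have : cover_compact [set: T] by rewrite -compact_cover.
  move=> /(_ T setT U (fun x _ => Uo x)) [|D _ TD].
    by move=> t _; exists t => //; rewrite /U /=; apply: ballxx; rewrite ltcR.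
  have loc (l : seq T) : exists s : borel T -> V, finite_measurable s /\
      forall t, (exists2 x, x \in l & U x t) -> rnorm (F t - s t) < eps.
    elim: l => [|x l [s [sm sl]]].
      by exists (fun=> 0); split=> [|t []//]; exact: finite_measurable_cst.
    exists (fun t => if t \in U x then F x else s t); split.
      apply: finite_measurable_if => //; last exact: finite_measurable_cst.
      exact: open_borel.
    move=> t [y]; rewrite in_cons; case: ifPn => [/set_mem/UE //|/negP Uxt].
    by case/orP => [/eqP-> /mem_set//|yl Uyt]; apply: sl; exists y.
  have [s [sm sF]] := loc (finmap.enum_fset D); exists s; split => // t; apply: sF.
  by have [x Dx Uxt] := TD t I; exists x.
have /choice[s sP] : forall n, exists s : borel T -> V,
    finite_measurable s /\ forall t, rnorm (F t - s t) < n.+1%:R^-1.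
  by move=> n; apply: approx; rewrite invr_gt0.
exists s; split => [n|t]; first by have [] := sP n.
apply: (@cvg_invSn _ _ _ _ 1) => // n; have [_ /(_ t) h] := sP n.
by rewrite -rnormE mul1r -(rmorph_nat (real_complex R)) -fmorphV lecR ltW.
Qed.

End CompactDomain.

(** * Bochner integrability for finite measures *)

Section BochnerCriterion.
Context d (T : measurableType d) (R : realType) (V : normedModType R[i]).
Variable mu : {measure set T -> \bar R}.
Hypothesis muT : (mu [set: T] < +oo)%E.

Lemma finite_measurable_bochner_simple (s : T -> V) :
  finite_measurable s -> bochner_simple mu s.
Proof.
move=> [fs ms]; split => // v _; apply: le_lt_trans muT.
by apply: le_measure; rewrite ?inE//; exact: ms.
Qed.

(** The approximants are set to [0] wherever their norm exceeds twice that of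
    [f].  This keeps the pointwise convergence and makes [3 |f|] a dominating
    function for the errors. *)
Lemma bochner_criterion (f : T -> V) : strongly_measurable f ->
  mu.-integrable [set: T] (fun t => (rnorm (f t))%:E) ->
  exists2 s, (forall n, finite_measurable (s n)) & bochner_approx mu f s.
Proof.
move=> fm fi; have [s [sm sf]] := fm.
pose E n := [set t | rnorm (s n t) <= 2 * rnorm (f t)].
have mE n : measurable (E n).
  have mg : measurable_fun [set: T] (fun t => 2 * rnorm (f t) - rnorm (s n t)).
    apply: measurable_funB; last first.
      apply: finite_measurable_fun.
      exact: (finite_measurable_comp (@rnorm R V) (sm n)).
    by apply: measurable_funM => //; exact: strongly_measurable_rnorm.
  have := mg measurableT `[0, +oo[%classic (measurable_itv _).
  rewrite setTI; congr measurable; apply/seteqP; split => t /=;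
    by rewrite in_itv/= andbT subr_ge0.
pose s' n t := if t \in E n then s n t else 0.
have s'm n : finite_measurable (s' n).
  by apply: finite_measurable_if => //; exact: finite_measurable_cst.
have s'f t : s' n t @[n --> \oo] --> f t.
  have [f0|f0] := eqVneq (f t) 0.
    rewrite f0 (_ : (fun n => s' n t) = fun=> 0); first exact: cvg_cst.
    apply/funext => n; rewrite /s'; case: ifPn => // /set_mem.
    rewrite /E/= f0 rnorm0 mulr0 => h.
    by apply/eqP; rewrite -rnorm_eq0 eq_le h rnorm_ge0.
  have rf : 0 < rnorm (f t) by rewrite lt0r rnorm_eq0 f0 rnorm_ge0.
  apply: cvg_trans (sf t); apply: near_eq_cvg.
  apply: filterS (cvg_rnorm rf (sf t)) => n h.
  rewrite /s' mem_set//= /E/= -[s n t](subrK (f t)) (le_trans (rnormD _ _))//.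
  by rewrite mulr_natl mulr2n lerD2r rnormBC ltW.
have s'le n t : rnorm (f t - s' n t) <= 3 * rnorm (f t).
  rewrite (le_trans (rnormD _ _))// rnormN (_ : 3 = 1 + 2)// mulrDl mul1r.
  rewrite lerD2l /s'; case: ifPn => [/set_mem//|_].
  by rewrite rnorm0 mulr_ge0// rnorm_ge0.
exists s' => //; split.
- by move=> n; exact: finite_measurable_bochner_simple.
- exact: aeW.
- have [|||||_ _] := @dominated_convergence _ _ _ mu _ measurableT
    (fun n t => (rnorm (f t - s' n t))%:E) (cst 0%E)
    (fun t => (3 * rnorm (f t))%:E) _ _ _ _ _.
  + move=> n; apply/measurable_EFinP.
    exact: strongly_measurable_rnorm (strongly_measurable_sub fm (s'm n)).
  + exact: measurable_cst.
  + apply: aeW => t _; apply: cvg_EFin; first exact: nearW.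
    have := lip_cvg (psi := fun v => rnorm (f t - v)) ler01 _ (s'f t).
    rewrite subrr rnorm0; apply => v w.
    rewrite mul1r (le_trans (rnorm_dist _ _))//.
    by rewrite opprB addrC addrA subrK rnormBC.
  + under eq_fun do rewrite EFinM.
    exact: integrableZl.
  + apply: aeW => t n _; rewrite gee0_abs ?lee_fin ?rnorm_ge0//.
  + by rewrite integral_cst//= mul0e.
Qed.

End BochnerCriterion.

(** * Completeness of the bounded operators and their coefficients *)

Section Complete.
Variables (R : realType) (H : hilbertType R).
Implicit Types (X Y Z : bop H) (x y : H).

(** The limit is taken pointwise; the uniform Cauchy estimate passes to the
    limit in one of its two indices. *)
Lemma bop_cauchy_seq_cvg (X : nat -> bop H) :
  (forall r : R, 0 < r -> exists N, forall n m, (N <= n)%N -> (N <= m)%N ->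
     `|X n - X m| <= r%:C) ->
  exists Z : bop H, X n @[n --> \oo] --> Z.
Proof.
move=> Xc.
have /choice[f fP] : forall x, exists z : H, X n x @[n --> \oo] --> z.
  move=> x; apply: cauchy_seq_cvg => r r0.
  have x1 : 0 < rnorm x + 1 by rewrite ltr_wpDl// rnorm_ge0.
  have [N XN] := Xc _ (divr_gt0 r0 x1); exists N => n m Nn Nm.
  rewrite -bop_subE (le_trans (bop_normP _ _))//.
  rewrite (le_trans (ler_wpM2r _ (XN _ _ Nn Nm)))// -rnormE -rmorphM lecR.
  by rewrite mulrAC ler_pdivrMr// ler_wpM2l ?lerDl// ltW.
have near_limit r N : (forall n m, (N <= n)%N -> (N <= m)%N ->
    `|X n - X m| <= r%:C) -> forall n x, (N <= n)%N ->
    `|f x - X n x| <= r%:C * `|x|.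
  move=> XN n x Nn.
  have lim : X m x - X n x @[m --> \oo] --> f x - X n x.
    by apply: cvgB; [exact: fP|exact: cvg_cst].
  apply: cvg_norm_le lim _; exists N => // m /= Nm.
  rewrite -bop_subE (le_trans (bop_normP _ _))// ler_wpM2r//.
  exact: XN.
have fb : f \in @bounded_op R H.
  apply/asboolP; split.
    move=> a x y; have h : X n (a *: x + y) @[n --> \oo] --> a *: f x + f y.
      under eq_fun do rewrite bop_linear.
      by apply: cvgD; [apply: cvgZr|]; exact: fP.
    exact: cvg_unique (fP _) h.
  have [N /near_limit fN] := Xc 1 ltr01.
  exists (1 + `|X N|) => x; rewrite -[f x](subrK (X N x)).
  rewrite (le_trans (ler_normD _ _))// mulrDl lerD ?bop_normP//.
  exact: fN.
exists (Bop fb); apply/cvgrPdist_le => eps /gtc0_real[r r0 ->].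
have [N /near_limit fN] := Xc r r0.
exists N => // n /= Nn; apply: bop_norm_le; first by rewrite lecR ltW.
by move=> x; exact: fN.
Qed.

(** The real part suffices, because multiplying [y] by a scalar gives access to
    every real linear combination of the real and imaginary parts. *)
Definition rcoef x y X : R := complex.Re ⟨X x, y⟩.

Lemma rcoefD x y X Y : rcoef x y (X + Y) = rcoef x y X + rcoef x y Y.
Proof. by rewrite /rcoef bop_addE innerDl raddfD. Qed.

Lemma rcoefB x y X Y : rcoef x y (X - Y) = rcoef x y X - rcoef x y Y.
Proof. by rewrite /rcoef bop_subE innerBl raddfB. Qed.

Lemma rcoefZ x y (r : R) X : rcoef x y (r%:C *: X) = r * rcoef x y X.
Proof.
rewrite /rcoef bop_scaleE innerZl; case: ⟨X x, y⟩ => a b /=.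
by rewrite mul0r subr0.
Qed.

Lemma rcoef0 x y : rcoef x y 0 = 0.
Proof. by have := rcoefB x y 0 0; rewrite !subrr. Qed.

Lemma rcoef_sum x y I (s : seq I) (F : I -> bop H) :
  rcoef x y (\sum_(i <- s) F i) = \sum_(i <- s) rcoef x y (F i).
Proof. by elim/big_ind2: _ => [|? ? ? ? <- <-|]//; rewrite ?rcoef0 ?rcoefD. Qed.

Lemma rcoef_le x y X : `|rcoef x y X| <= rnorm x * rnorm y * rnorm X.
Proof.
rewrite -lecR (le_trans (normc_ge_Re _))// !rmorphM/= !rnormE.
rewrite (le_trans (cauchy_schwarz _ _))// mulrAC ler_wpM2r//.
by rewrite mulrC bop_normP.
Qed.

Lemma rcoef_lip x y X Y :
  `|rcoef x y X - rcoef x y Y| <= rnorm x * rnorm y * rnorm (X - Y).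
Proof. by rewrite -rcoefB rcoef_le. Qed.

Lemma rcoef_self x X : rcoef x (X x) X = rnorm (X x) ^+ 2.
Proof. by rewrite /rcoef inner_norm -rnormE -rmorphXn. Qed.

(** Taking [y = X x] turns the coefficient into [|X x|^2]. *)
Lemma rnorm_le_rcoef X (C : R) : 0 <= C ->
  (forall x y, `|rcoef x y X| <= rnorm x * rnorm y * C) -> rnorm X <= C.
Proof.
move=> C0 XC; rewrite -lecR rnormE; apply: bop_norm_le; first by rewrite lecR.
move=> x; rewrite -!rnormE -rmorphM lecR.
have [->|X0] := eqVneq (X x) 0; first by rewrite rnorm0 mulr_ge0// rnorm_ge0.
have r0 : 0 < rnorm (X x) by rewrite lt0r rnorm_eq0 X0 rnorm_ge0.
rewrite -(ler_pM2r r0) -expr2 -rcoef_self (le_trans (ler_norm _))//.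
by rewrite (le_trans (XC _ _))// mulrC mulrA.
Qed.

Lemma rcoef_inj X Y : (forall x y, rcoef x y X = rcoef x y Y) -> X = Y.
Proof.
move=> XY; apply/eqP; rewrite -subr_eq0 -rnorm_eq0 eq_le rnorm_ge0 andbT.
apply: rnorm_le_rcoef => // x y.
by rewrite rcoefB XY subrr normr0 mulr0.
Qed.

End Complete.

(** * Coefficients of the Bochner integral *)

Section FiniteMeasure.
Context d (T : measurableType d) (R : realType).
Variable mu : {measure set T -> \bar R}.
Hypothesis muT : (mu [set: T] < +oo)%E.

Lemma finite_measurable_integrable (g : T -> R) : finite_measurable g ->
  mu.-integrable [set: T] (EFin \o g).
Proof.
move=> gm; apply: measurable_bounded_integrable => //.
  exact: finite_measurable_fun.
have [fg _] := gm; pose M := \sum_(v <- finmap.enum_fset (fset_set (range g))) `|v|.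
(* The sum of the finitely many absolute values is a crude upper bound. *)
exists M; split; first exact: num_real.
move=> r Mr t _ /=; apply: ltW; apply: le_lt_trans Mr.
have gt : g t \in finmap.enum_fset (fset_set (range g)).
  by have := in_fset_set fg (g t); rewrite mem_set //; exists t.
by rewrite /M (big_rem _ gt)/= lerDl sumr_ge0.
Qed.

Lemma Rintegral_sum I (r : seq I) (F : I -> T -> R) :
  (forall i, mu.-integrable [set: T] (EFin \o F i)) ->
  mu.-integrable [set: T] (EFin \o (fun t => \sum_(i <- r) F i t)) /\
  \int[mu]_t \sum_(i <- r) F i t = \sum_(i <- r) \int[mu]_t F i t.
Proof.
move=> Fi; elim: r => [|i r [ihi ih]].
  split; first by under eq_fun do rewrite big_nil; exact: integrable0.
  by under eq_Rintegral do rewrite big_nil; rewrite big_nil Rintegral_cst// mul0r.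
split.
  have := integrableD measurableT (Fi i) ihi.
  by congr integrable; apply/funext => t; rewrite /= big_cons.
under eq_Rintegral do rewrite big_cons.
by rewrite RintegralD// ih big_cons.
Qed.

Section OperatorValued.
Variable H : hilbertType R.
Implicit Types (f s : T -> bop H) (x y : H).

Lemma rcoef_sintegral x y s : finite_measurable s ->
  rcoef x y (bochner_sintegral mu s) = \int[mu]_t rcoef x y (s t).
Proof.
move=> [fs ms]; rewrite /bochner_sintegral fsbig_finite// rcoef_sum.
set D := finmap.enum_fset _.
have Dt t : s t \in D.
  by have := in_fset_set fs (s t); rewrite mem_set //; exists t.
have Du : uniq D by exact: finmap.fset_uniq.
have sE t : rcoef x y (s t) =
    \sum_(v <- D) rcoef x y v * \1_(s @^-1` [set v]) t.
  rewrite (bigD1_seq (s t))//= indicE mem_set// mulr1 big1 ?addr0// => v vt.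
  rewrite indicE memNset ?mulr0//= => sv.
  by rewrite sv eqxx in vt.
under eq_Rintegral do rewrite sE.
have indm v : finite_measurable (\1_(s @^-1` [set v]) : T -> R).
  have -> : (\1_(s @^-1` [set v]) : T -> R) = (\1_[set v] : bop H -> R) \o s.
    by apply/funext => t; rewrite /= !indicE; congr (nat_of_bool _)%:R;
      apply/idP/idP => /set_mem h; exact/mem_set.
  exact: finite_measurable_comp.
rewrite (Rintegral_sum _ _).2; last first.
  move=> v; apply: finite_measurable_integrable.
  exact: (finite_measurable_comp (fun r => rcoef x y v * r) (indm v)).
apply: eq_bigr => v _; rewrite rcoefZ RintegralZl//; last first.
  exact: finite_measurable_integrable.
by rewrite mulrC /Rintegral integral_indic// setIT.
Qed.

Variable f : T -> bop H.
Hypothesis fm : strongly_measurable f.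
Hypothesis fi : mu.-integrable [set: T] (fun t => (rnorm (f t))%:E).

Lemma integrable_rcoef x y : mu.-integrable [set: T] (fun t => (rcoef x y (f t))%:E).
Proof.
have C0 : 0 <= rnorm x * rnorm y by rewrite mulr_ge0// rnorm_ge0.
apply: (le_integrable measurableT _ _ (integrableZl measurableT (rnorm x * rnorm y) fi)).
  apply/measurable_EFinP.
  exact: (strongly_measurable_fun C0 (rcoef_lip x y) fm).
move=> t _; rewrite -EFinM !abse_EFin lee_fin (le_trans (rcoef_le _ _ _))//.
exact: ler_norm.
Qed.

Lemma integrable_rnorm_sub s : finite_measurable s ->
  mu.-integrable [set: T] (fun t => (rnorm (f t - s t))%:E).
Proof.
move=> sm; have si : mu.-integrable [set: T] (fun t => (rnorm (s t))%:E).
  apply: finite_measurable_integrable.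
  exact: (finite_measurable_comp (@rnorm R (bop H)) sm).
apply: (le_integrable measurableT _ _ (integrableD measurableT fi si)).
  apply/measurable_EFinP.
  exact: strongly_measurable_rnorm (strongly_measurable_sub fm sm).
move=> t _; rewrite -EFinD !abse_EFin lee_fin.
rewrite ger0_norm ?rnorm_ge0// ger0_norm ?addr_ge0 ?rnorm_ge0//.
by rewrite (le_trans (rnormD _ _))// rnormN.
Qed.

(** This yields both that the integrals of approximants form a Cauchy sequence,
    uniformly for [x] and [y] in the unit ball, and the value of their limit. *)
Lemma rcoef_sintegral_dist x y s : finite_measurable s ->
  `|rcoef x y (bochner_sintegral mu s) - \int[mu]_t rcoef x y (f t)| <=
  rnorm x * rnorm y * \int[mu]_t rnorm (f t - s t).
Proof.
move=> sm; rewrite rcoef_sintegral// distrC.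
have ci := integrable_rcoef x y.
have csi : mu.-integrable [set: T] (fun t => (rcoef x y (s t))%:E).
  apply: finite_measurable_integrable.
  exact: (finite_measurable_comp (rcoef x y) sm).
have ni := integrable_rnorm_sub sm.
rewrite -RintegralB// -RintegralZl//.
have bi := integrableB measurableT ci csi.
apply: le_trans (le_normr_Rintegral measurableT bi) _.
apply: le_Rintegral => //.
- exact: integrable_abse bi.
- by have := integrableZl measurableT (rnorm x * rnorm y) ni.
- by move=> t _; exact: rcoef_lip.
Qed.

Lemma bochner_integral_spec :
  exists s : nat -> T -> bop H,
    (forall n, finite_measurable (s n)) /\ bochner_approx mu f s /\
    exists I : bop H, bochner_sintegral mu (s n) @[n --> \oo] --> (I : bop H).
Proof.
have [s sm sf] := bochner_criterion muT fm fi.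
exists s; split => //; split => //; apply: bop_cauchy_seq_cvg => r r0.
have [_ _ /fine_cvg/cvgr0Pnorm_lt/(_ _ (divr_gt0 r0 (ltr0n _ 2)))] := sf.
case=> N _ sN; exists N => n m Nn Nm.
have dist k : (N <= k)%N -> \int[mu]_t rnorm (f t - s k t) <= r / 2.
  by move=> Nk; rewrite (le_trans (ler_norm _))// ltW// sN.
rewrite -rnormE lecR; apply: rnorm_le_rcoef => [|x y]; first exact: ltW.
have C0 : 0 <= rnorm x * rnorm y by rewrite mulr_ge0// rnorm_ge0.
rewrite rcoefB; set c := \int[mu]_t rcoef x y (f t).
rewrite -(subrK c (rcoef x y (bochner_sintegral mu (s n)))) -addrA.
rewrite (le_trans (ler_normD _ _))// [r]splitr mulrDr lerD//; last rewrite distrC.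
  by rewrite (le_trans (rcoef_sintegral_dist _ _ _))// ler_wpM2l// dist.
by rewrite (le_trans (rcoef_sintegral_dist _ _ _))// ler_wpM2l// dist.
Qed.

(** The equality holds for every limit of integrals of approximants, so it does
    not matter which one the definition of the integral selects. *)
Lemma rcoef_bochner_integral x y :
  rcoef x y (bochner_integral mu f) = \int[mu]_t rcoef x y (f t).
Proof.
have [s0 [s0m [s0f [I0 sI0]]]] := bochner_integral_spec.
rewrite /bochner_integral; case: xgetP => [I _ [s sf sI]|/(_ I0)]; last first.
  by case; exists s0.
have [ss _ fs] := sf.
have sm n : finite_measurable (s n) by have [] := ss n.
have C0 : 0 <= rnorm x * rnorm y by rewrite mulr_ge0// rnorm_ge0.
have h1 := lip_cvg C0 (rcoef_lip x y) sI.
suff h2 : rcoef x y (bochner_sintegral mu (s n)) @[n --> \oo] -->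
    \int[mu]_t rcoef x y (f t) by exact: cvg_unique h1 h2.
have e0 : (rnorm x * rnorm y) * \int[mu]_t rnorm (f t - s n t) @[n --> \oo]
    --> (0 : R).
  rewrite -[0](mulr0 (rnorm x * rnorm y)).
  by apply: cvgM; [exact: cvg_cst|exact: fine_cvg fs].
apply/cvgrPdist_lt => eps eps0.
have /cvgr0Pnorm_lt/(_ _ eps0) := e0.
apply: filterS => n /(le_lt_trans (ler_norm _)); apply: le_lt_trans.
by rewrite distrC rcoef_sintegral_dist.
Qed.

End OperatorValued.
End FiniteMeasure.

(** * Coefficients and continuity of the Hadamard product *)

Section HadamardCoefficients.
Variables (R : realType) (H : hilbertType R) (J : eqType) (e : J -> H).
Hypothesis he : orthonormal_basis e.
Implicit Types (X Y Z : bop H) (x y : H).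

Lemma hadamardC X Y : hadamard e X Y = hadamard e Y X.
Proof. by apply: (bop_basis_inj he) => i j; rewrite !hadamardE// mulrC. Qed.

Lemma hadamardBl X X' Y :
  hadamard e (X - X') Y = hadamard e X Y - hadamard e X' Y.
Proof.
by rewrite addrC -scaleN1r (hadamard_linearl he) scaleN1r addrC.
Qed.

Lemma hadamardBr X Y Y' :
  hadamard e X (Y - Y') = hadamard e X Y - hadamard e X Y'.
Proof. by rewrite ![hadamard e X _]hadamardC hadamardBl. Qed.

Lemma rcoef_basis_inj X Y :
  (forall i j a, rcoef (e i) (a *: e j) X = rcoef (e i) (a *: e j) Y) -> X = Y.
Proof.
move=> XY; apply: (bop_basis_inj he) => i j.
have := XY i j 'i; have := XY i j 1; rewrite /rcoef !innerZr.
case: ⟨X (e i), e j⟩ => a b; case: ⟨Y (e i), e j⟩ => a' b' /=.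
rewrite !mul1r !mul0r !oppr0 !mul0r !subr0 !sub0r !mulN1r !opprK.
by move=> -> ->.
Qed.

(** Taking the Hadamard product with [Y] multiplies each entry by a constant,
    which can be moved into the second vector: a coefficient of the product is
    again a coefficient of [X].  This is why integration commutes with it. *)
Lemma rcoef_hadamard i j a X Y :
  rcoef (e i) (a *: e j) (hadamard e X Y) =
  rcoef (e i) ((a * (⟨Y (e i), e j⟩)^*) *: e j) X.
Proof.
rewrite /rcoef !innerZr (hadamardE he) rmorphM/= conjCK -mulrA.
by congr (complex.Re (_ * _)); rewrite mulrC.
Qed.

(** In the order of the complex numbers, being nonnegative includes being
    real; the imaginary part of [<X x, x>] is the coefficient at [x] and
    ['i x]. *)
Lemma op_posP X :
  op_pos X <-> (forall x, 0 <= rcoef x x X) /\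
               (forall x, rcoef x ('i *: x) X = 0).
Proof.
have iE x : rcoef x ('i *: x) X = complex.Im ⟨X x, x⟩.
  rewrite /rcoef innerZr; case: ⟨X x, x⟩ => a b /=.
  by rewrite mul0r sub0r mulN1r opprK.
split=> [Xp|[X1 X2] x].
  by split => x; have := Xp x; rewrite lecE => /andP[/eqP /= Im0 Re0];
    rewrite ?iE.
by rewrite lecE /= -iE X2 eqxx/=; exact: X1.
Qed.

Lemma hadamard_continuous (T : topologicalType) (F G : T -> bop H) :
  continuous F -> continuous G -> continuous (fun t => hadamard e (F t) (G t)).
Proof.
move=> cF cG t.
have g0 : `|F t - F u| * `|G u| + `|F t| * `|G t - G u| @[u --> t] -->
    (0 : R[i]^o).
  have -> : 0 = `|F t - F t| * `|G t| + `|F t| * `|G t - G t| :> R[i]^o.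
    by rewrite !subrr !normr0 mul0r mulr0 addr0.
  have dF : F t - F u @[u --> t] --> F t - F t.
    by apply: cvgB; [exact: cvg_cst|exact: cF].
  have dG : G t - G u @[u --> t] --> G t - G t.
    by apply: cvgB; [exact: cvg_cst|exact: cG].
  apply: cvgD; apply: cvgM.
  - exact: cvg_norm dF.
  - exact: cvg_norm (cG t).
  - exact: cvg_cst.
  - exact: cvg_norm dG.
apply/cvgrPdist_lt => eps eps0; have /cvgr0Pnorm_lt/(_ _ eps0) := g0.
apply: filterS => u; apply: le_lt_trans.
rewrite ger0_norm; last by rewrite addr_ge0// mulr_ge0.
have -> : hadamard e (F t) (G t) - hadamard e (F u) (G u) =
    hadamard e (F t - F u) (G u) + hadamard e (F t) (G t - G u).
  by rewrite hadamardBl hadamardBr [RHS]addrC addrA subrK.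
by rewrite (le_trans (ler_normD _ _))// lerD// hadamard_norm.
Qed.

End HadamardCoefficients.

(** * Weighted integrals of continuous fields on a compact space *)

Section WeightedIntegral.
Variables (R : realType) (H : hilbertType R) (T : ptopologicalType).
Hypothesis Tc : compact [set: T].
Variable mu : {measure set (borel T) -> \bar R}.
Hypothesis muT : (mu [set: borel T] < +oo)%E.
Variable alpha : borel T -> R.
Hypothesis alpha0 : forall t, 0 <= alpha t.
Hypothesis malpha : measurable_fun [set: borel T] alpha.
Hypothesis ialpha : mu.-integrable [set: borel T] (EFin \o alpha).
Implicit Types (F G : T -> bop H) (x y : H).

Definition opint F : bop H := \bint[mu]_t ((alpha t)%:C *: F t).

Lemma continuous_bounded F : continuous F ->
  exists M, 0 <= M /\ forall t, rnorm (F t) <= M.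
Proof.
move=> cF; have cg : continuous (fun t => rnorm (F t) : R).
  move=> t; apply/cvgrPdist_lt => r r0.
  have r0' : 0 < r%:C by rewrite ltcR.
  have /cvgrPdist_lt/(_ _ r0') := cF t; apply: filterS => u.
  by rewrite -rnormE ltcR; apply: le_lt_trans; exact: rnorm_dist.
have : compact ((fun t => rnorm (F t) : R) @` [set: T]).
  by apply: continuous_compact => //; exact: continuous_subspaceT.
move=> /compact_bounded[M [Mr FM]].
exists (`|M| + 1); split => [|t]; first by rewrite addr_ge0.
rewrite -[leLHS]ger0_norm ?rnorm_ge0//; apply: FM; last by exists t.
by rewrite (le_lt_trans (ler_norm M))// ltrDl.
Qed.

Lemma weighted_strongly_measurable F : continuous F ->
  strongly_measurable (fun t : borel T => (alpha t)%:C *: F t).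
Proof.
by move=> cF; apply: strongly_measurable_scale => //;
  exact: continuous_strongly_measurable.
Qed.

Lemma weighted_integrable F : continuous F ->
  mu.-integrable [set: borel T]
    (fun t : borel T => (rnorm ((alpha t)%:C *: F t))%:E).
Proof.
move=> cF; have [M [M0 FM]] := continuous_bounded cF.
apply: (le_integrable measurableT _ _ (integrableZl measurableT M ialpha)).
  apply/measurable_EFinP; apply: strongly_measurable_rnorm.
  exact: weighted_strongly_measurable.
move=> t _; rewrite -EFinM !abse_EFin lee_fin ger0_norm ?rnorm_ge0//.
rewrite (le_trans _ (ler_norm _))// mulrC.
have -> : rnorm ((alpha t)%:C *: F t) = alpha t * rnorm (F t).
  apply: complexI; rewrite rmorphM/= !rnormE normrZ normc_real ger0_norm//.
by rewrite ler_wpM2l.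
Qed.

Lemma rcoef_opint F x y : continuous F ->
  rcoef x y (opint F) = \int[mu]_t (alpha t * rcoef x y (F t)).
Proof.
move=> cF; rewrite /opint rcoef_bochner_integral//.
- by apply: eq_Rintegral => t _; rewrite rcoefZ.
- exact: weighted_strongly_measurable.
- exact: weighted_integrable.
Qed.

Lemma integrable_weighted_rcoef F x y : continuous F ->
  mu.-integrable [set: borel T]
    (EFin \o (fun t : borel T => alpha t * rcoef x y (F t))).
Proof.
move=> cF; have := integrable_rcoef (weighted_strongly_measurable cF)
  (weighted_integrable cF) x y.
by congr integrable; apply/funext => t; rewrite /= rcoefZ.
Qed.

Lemma opintD F G : continuous F -> continuous G ->
  opint (fun t => F t + G t) = opint F + opint G.
Proof.
move=> cF cG; have cFG : continuous (fun t => F t + G t).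
  by move=> t; apply: cvgD; [exact: cF|exact: cG].
apply: rcoef_inj => x y; rewrite [LHS](rcoef_opint x y cFG) [RHS]rcoefD.
rewrite [X in _ = X + _](rcoef_opint x y cF).
rewrite [X in _ = _ + X](rcoef_opint x y cG).
rewrite -RintegralD//; try exact: integrable_weighted_rcoef.
by apply: eq_Rintegral => t _; rewrite rcoefD mulrDr.
Qed.

Lemma opintB F G : continuous F -> continuous G ->
  opint (fun t => F t - G t) = opint F - opint G.
Proof.
move=> cF cG; have cFG : continuous (fun t => F t - G t).
  by move=> t; apply: cvgB; [exact: cF|exact: cG].
apply: rcoef_inj => x y; rewrite [LHS](rcoef_opint x y cFG) [RHS]rcoefB.
rewrite [X in _ = X - _](rcoef_opint x y cF).
rewrite [X in _ = _ - X](rcoef_opint x y cG).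
rewrite -RintegralB//; try exact: integrable_weighted_rcoef.
by apply: eq_Rintegral => t _; rewrite rcoefB mulrBr.
Qed.

(** The shape shared by the two integrations of the main argument. *)
Lemma opint_eq4 F1 F2 F3 F4 (I1 I2 I3 I4 : bop H) :
  continuous F1 -> continuous F2 -> continuous F3 -> continuous F4 ->
  opint F1 = I1 -> opint F2 = I2 -> opint F3 = I3 -> opint F4 = I4 ->
  opint (fun t => F1 t + F2 t - F3 t - F4 t) = I1 + I2 - I3 - I4.
Proof.
move=> c1 c2 c3 c4 <- <- <- <-.
have c12 : continuous (fun t => F1 t + F2 t).
  by move=> t; apply: cvgD; [exact: c1|exact: c2].
have c123 : continuous (fun t => F1 t + F2 t - F3 t).
  by move=> t; apply: cvgB; [exact: c12|exact: c3].
by rewrite (opintB c123 c4) (opintB c12 c3) (opintD c1 c2).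
Qed.

Lemma opintZ (r : R) F : continuous F ->
  opint (fun t => r%:C *: F t) = r%:C *: opint F.
Proof.
move=> cF; have crF : continuous (fun t => r%:C *: F t).
  by move=> t; apply: cvgZr; exact: cF.
apply: rcoef_inj => x y; rewrite [LHS](rcoef_opint x y crF) [RHS]rcoefZ.
rewrite [X in _ = _ * X](rcoef_opint x y cF).
rewrite -RintegralZl//; last exact: integrable_weighted_rcoef.
by apply: eq_Rintegral => t _; rewrite rcoefZ mulrCA.
Qed.

Lemma opint_cst (X : bop H) :
  opint (fun=> X) = (\int[mu]_t alpha t)%:C *: X.
Proof.
have cX : continuous (fun _ : T => X) by exact: cst_continuous.
apply: rcoef_inj => x y; rewrite [LHS](rcoef_opint x y cX) [RHS]rcoefZ.
by rewrite RintegralZr.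
Qed.

Lemma opint_pos F : continuous F -> (forall t, op_pos (F t)) ->
  op_pos (opint F).
Proof.
move=> cF Fp; apply/op_posP; split=> x; rewrite (rcoef_opint _ _ cF).
  apply: Rintegral_ge0 => t _; rewrite mulr_ge0//.
  by have /op_posP[] := Fp t.
under eq_Rintegral => t _ do rewrite ((op_posP _).1 (Fp t)).2 mulr0.
by rewrite Rintegral_cst// mul0r.
Qed.

Variables (J : eqType) (e : J -> H).
Hypothesis he : orthonormal_basis e.

Lemma opint_hadamardl F (Y : bop H) : continuous F ->
  opint (fun t => hadamard e (F t) Y) = hadamard e (opint F) Y.
Proof.
move=> cF; apply: (rcoef_basis_inj he) => i j a.
have cFY : continuous (fun t => hadamard e (F t) Y).
  by apply: hadamard_continuous => //; exact: cst_continuous.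
rewrite [LHS](rcoef_opint _ _ cFY) [RHS](rcoef_hadamard he).
rewrite [RHS](rcoef_opint _ _ cF).
by apply: eq_Rintegral => t _; rewrite (rcoef_hadamard he).
Qed.

Lemma opint_hadamardr F (X : bop H) : continuous F ->
  opint (fun t => hadamard e X (F t)) = hadamard e X (opint F).
Proof.
move=> cF; rewrite [RHS](hadamardC he) -[RHS](opint_hadamardl _ cF).
by congr opint; apply/funext => t; rewrite [LHS](hadamardC he).
Qed.

End WeightedIntegral.


(** * The inequality *)

Theorem theorem2p1 (R : realType) (H : hilbertType R)
  (J : eqType) (e : J -> H) (he : orthonormal_basis e)
  (AA : set (bop H)) (hAA : cstar_algebra AA)
  (T : ptopologicalType) (hTc : compact [set: T]) (hTh : hausdorff_space T)
  (mu : {measure set (borel T) -> \bar R}) (hmu : radon_measure mu)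
  (A B : T -> bop H)
  (hA : continuous_field mu AA A) (hB : continuous_field mu AA B)
  (hAB : synchronous_hadamard e A B)
  (alpha beta : borel T -> R)
  (alpha0 : forall t, 0 <= alpha t) (beta0 : forall t, 0 <= beta t)
  (malpha : measurable_fun [set: borel T] alpha)
  (mbeta : measurable_fun [set: borel T] beta)
  (ialpha : mu.-integrable [set: borel T] (EFin \o alpha))
  (ibeta : mu.-integrable [set: borel T] (EFin \o beta)) :
  (\int[mu]_s alpha s)%:C *:
      (\bint[mu]_t ((beta t)%:C *: hadamard e (A t) (B t)))
    + (\int[mu]_s beta s)%:C *:
      (\bint[mu]_t ((alpha t)%:C *: hadamard e (A t) (B t)))
  >=op
  hadamard e (\bint[mu]_t ((alpha t)%:C *: A t))
             (\bint[mu]_s ((beta s)%:C *: B s))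
    + hadamard e (\bint[mu]_t ((beta t)%:C *: A t))
                 (\bint[mu]_s ((alpha s)%:C *: B s)).
Proof.
have muT : (mu [set: borel T] < +oo)%E by have [+ _ _] := hmu; exact.
have [_ cA _] := hA; have [_ cB _] := hB.
set a := \int[mu]_s alpha s; set b := \int[mu]_s beta s.
pose AB t := hadamard e (A t) (B t).
change (op_pos (a%:C *: opint mu beta AB + b%:C *: opint mu alpha AB -
  (hadamard e (opint mu alpha A) (opint mu beta B) +
   hadamard e (opint mu beta A) (opint mu alpha B)))).
set P := opint mu alpha AB; set PA := opint mu alpha A.
set PB := opint mu alpha B.
have cst (X : bop H) : continuous (fun _ : T => X) by exact: cst_continuous.
have cAB : continuous AB by exact: hadamard_continuous.
have cAY Y : continuous (fun t => hadamard e (A t) Y).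
  exact: hadamard_continuous.
have cXB X : continuous (fun t => hadamard e X (B t)).
  exact: hadamard_continuous.
have caAB : continuous (fun t => a%:C *: AB t).
  by move=> t; apply: cvgZr; exact: cAB.
have cN (F G : T -> bop H) :
    continuous F -> continuous G -> continuous (fun t => F t - G t).
  by move=> cF cG t; apply: cvgB; [exact: cF|exact: cG].
pose G t := a%:C *: AB t + P - hadamard e (A t) PB - hadamard e PA (B t).
have cG : continuous G.
  apply: (cN _ _ _ (cXB PA)); apply: (cN _ _ _ (cAY PB)).
  by move=> t; apply: cvgD; [exact: caAB|exact: cvg_cst].
have alg0 (u v w z : bop H) : u - w - (z - v) = u + v - w - z.
  by rewrite opprB addrA [u - w + v]addrAC.
have GE t : opint mu alpha (fun s => hadamard e (A t - A s) (B t - B s)) = G t.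
  have -> : (fun s => hadamard e (A t - A s) (B t - B s)) = fun s =>
      AB t + AB s - hadamard e (A t) (B s) - hadamard e (A s) (B t).
    apply/funext => s; rewrite (hadamardBl he) !(hadamardBr he) -/(AB t).
    by rewrite -/(AB s) alg0.
  apply: (opint_eq4 hTc muT alpha0 malpha ialpha (cst _) cAB (cXB _) (cAY _)).
  - exact: opint_cst.
  - by [].
  - exact: opint_hadamardr.
  - exact: opint_hadamardl.
have G0 t : op_pos (G t).
  rewrite -GE; apply: (opint_pos hTc muT alpha0 malpha ialpha _ (hAB^~ t)).
  by apply: hadamard_continuous => //; exact: cN.
have EI : opint mu beta G = a%:C *: opint mu beta AB + b%:C *: P -
    hadamard e (opint mu beta A) PB - hadamard e PA (opint mu beta B).
  apply: (opint_eq4 hTc muT beta0 mbeta ibeta caAB (cst _) (cAY _) (cXB _)).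
  - exact: opintZ.
  - exact: opint_cst.
  - exact: opint_hadamardl.
  - exact: opint_hadamardr.
have := opint_pos hTc muT beta0 mbeta ibeta cG G0; rewrite EI.
have alg (u v w z : bop H) : u + v - w - z = u + v - (z + w).
  by rewrite opprD addrA addrAC.
by rewrite alg.
Qed.
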